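(* For every real $c\ge 4$ and every matrix $M$: if $M\in TP_2(c)$, then $M\in STP$.
   Context: For $c\ge 1$, $TP_2(c)$ denotes the class of all real matrices $M=(a_{i,j})$ with positive entries such that $a_{i,j}a_{i+1,j+1}\ge c\, a_{i,j+1}a_{i+1,j}$ for all $i,j$ (for which these entries exist). $STP$ is the class of matrices all of whose minors (of all orders, formed by arbitrary rows and columns taken in increasing order) are strictly positive. *)

(* Defs.v *)
From HB Require Import structures.
From mathcomp Require Import all_boot all_order all_algebra reals.

Set Implicit Arguments.
Unset Strict Implicit.
Unset Printing Implicit Defensive.

Import Order.TTheory GRing.Theory Num.Theory.
Local Open Scope ring_scope.

(* A real matrix whose rows are indexed by the integers in the interval I and
   whose columns are indexed by those in J is a function a : int -> int -> R, of
   which only the values on I x J are entries.  A finite m x n matrix has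
   I = `[1, m] and J = `[1, n]; unbounded intervals give infinite matrices. *)

Definition TP2 (R : realType) (c : R) (I J : interval int)
    (a : int -> int -> R) : Prop :=
  (forall i j : int, i \in I -> j \in J -> 0 < a i j) /\
  (forall i j : int, i \in I -> i + 1 \in I -> j \in J -> j + 1 \in J ->
     c * (a i (j + 1) * a (i + 1) j) <= a i j * a (i + 1) (j + 1)).

Definition minor (R : realType) (a : int -> int -> R) (k : nat)
    (r s : 'I_k -> int) : R :=
  \det (\matrix_(p < k, q < k) a (r p) (s q)).

(* Order k = 0 is harmless: the empty minor is 1. *)
Definition STP (R : realType) (I J : interval int)
    (a : int -> int -> R) : Prop :=
  forall (k : nat) (r s : 'I_k -> int),
    (forall p, r p \in I) -> (forall q, s q \in J) ->
    (forall p q : 'I_k, (p < q)%N -> r p < r q) ->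
    (forall p q : 'I_k, (p < q)%N -> s p < s q) ->
    0 < minor a r s.

(* Main.v *)
Require Import Defs.
From HB Require Import structures.
From mathcomp Require Import all_boot all_order all_algebra reals.
From mathcomp Require Import zify ring lra.

Set Implicit Arguments.
Unset Strict Implicit.
Unset Printing Implicit Defensive.

Import Order.TTheory GRing.Theory Num.Theory.
Local Open Scope ring_scope.

(** The reason is that Laplace expansion along the last row has rapidly growing
    terms.  Let [b] be a square matrix with [n + 1] rows, with [T j] the entry
    of the last row in column [j] times the complementary minor, so that the
    determinant is the alternating sum [T n - T (n - 1) + T (n - 2) - ...].
    The terms are nonnegative by induction on the size.  If
    [2 * T j <= T (j + 1)] for all [j], the sum lies between [T n / 2] and
    [T n]: adding a row and a column multiplies a leading minor by the new
    diagonal entry, up to a factor between 1/2 and 1 ([tame_minors]).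

    This statement feeds back into the growth of [T].  The minors in [T j] and
    [T (j + 1)] come from matrices that differ in one column only, the one with
    index [j].  Comparing both of them with their common leading minor of order
    [j] times the product of their diagonal entries from position [j] on costs
    at most a factor [2 ^ (n - j)], while the ratio of [b j j * b n (j + 1)] to
    [b j (j + 1) * b n j], the entries that differ, is at least
    [4 ^ (n - j)], because the 2 x 2 condition for neighbouring entries
    telescopes.  What is left is
    [2 ^ (n - j) >= 2] ([laplace_term_growth]); induction on the size closes the
    loop ([tp2_tame]).  Every minor is itself the determinant of a matrix of the
    same kind, again by telescoping ([tp2_minor]). *)

(** * Telescoping the 2 x 2 condition *)

(** Multiplying the conditions for consecutive indices cancels all the entries
    strictly between the two ends. *)
Lemma ratio_telescope (R : realFieldType) (x : R) (f g : nat -> R) (d : nat) :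
  0 <= x ->
  (forall t, (t <= d)%N -> 0 < f t) -> (forall t, (t <= d)%N -> 0 < g t) ->
  (forall t, (t < d)%N -> x * (g t * f t.+1) <= f t * g t.+1) ->
  x ^+ d * (g 0 * f d) <= f 0 * g d.
Proof.
move=> x0; elim: d => [|d IH] f0 g0 h; first by rewrite expr0 mul1r mulrC.
have fd : 0 < f d by exact: f0.
have gd : 0 < g d by exact: g0.
have gz : 0 < g 0%N by exact: g0.
have fS : 0 < f d.+1 by exact: f0.
have {}IH : x ^+ d * (g 0 * f d) <= f 0 * g d.
  apply: IH => t td; [apply: f0|apply: g0|apply: h]; lia.
have hd := h d (ltnSn d).
rewrite -(ler_pM2r (mulr_gt0 fd gd)).
have -> : x ^+ d.+1 * (g 0 * f d.+1) * (f d * g d) =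
  (x ^+ d * (g 0 * f d)) * (x * (g d * f d.+1)) by rewrite exprS; ring.
have -> : f 0 * g d.+1 * (f d * g d) = (f 0 * g d) * (f d * g d.+1) by ring.
apply: ler_pM => //.
  by rewrite mulr_ge0 ?exprn_ge0 ?mulr_ge0 ?(ltW gz) ?(ltW fd).
by rewrite !mulr_ge0 ?(ltW gd) ?(ltW fS).
Qed.

Lemma interval_convex (I : interval int) (i k : int) (d t : nat) :
  i \in I -> i + d%:Z \in I -> (t <= d)%N -> i + t%:Z \in I.
Proof.
case: I => [[[] l|[]] [[] u|[]]]; rewrite !itv_boundlr ?bnd_simp //=;
  by [lia|move=> /andP[]].
Qed.

(** The determinant arguments need a condition on the matrix [b] restricted to
    indices below [n] that survives deleting columns; the factor [4 ^ (i' - i)]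
    for distant rows, with no gain from distant columns, is enough. *)
Definition tp2_4 (R : realType) (n : nat) (b : nat -> nat -> R) : Prop :=
  (forall i j, (i < n)%N -> (j < n)%N -> 0 < b i j) /\
  (forall i i' j j', (i < i' < n)%N -> (j < j' < n)%N ->
     4 ^+ (i' - i) * (b i j' * b i' j) <= b i j * b i' j').

Lemma tp2_4_sub (R : realType) (n m : nat) (b : nat -> nat -> R) :
  (m <= n)%N -> tp2_4 n b -> tp2_4 m b.
Proof.
move=> mn [b0 h]; split=> [i j im jm|i i' j j' hi hj].
  by apply: b0; lia.
by apply: h; lia.
Qed.

(** Telescoping first over columns, then over rows: the gain 4 for arbitrary
    2 x 2 minors makes the condition pass to submatrices. *)
Lemma TP2_spread (R : realType) (c : R) (I J : interval int)
    (a : int -> int -> R) (i i' j j' : int) :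
  4 <= c -> TP2 c I J a ->
  i \in I -> i' \in I -> i < i' -> j \in J -> j' \in J -> j < j' ->
  4 * (a i j' * a i' j) <= a i j * a i' j'.
Proof.
move=> c4 [a0 h] iI i'I ii' jJ j'J jj'.
have le4 d (x y : R) : 0 <= x -> 4 ^+ d.+1 * x <= y -> 4 * x <= y.
  move=> x0; apply: le_trans; apply: ler_wpM2r => //.
  by rewrite exprS ler_peMr // exprn_ege1 // (_ : 1 = 1%:R) // ler_nat.
have [d dE] : exists d : nat, i' = i + d.+1%:Z.
  by exists (absz (i' - i - 1)%R); lia.
have [e eE] : exists e : nat, j' = j + e.+1%:Z.
  by exists (absz (j' - j - 1)%R); lia.
subst i' j'.
have rows t : (t <= d.+1)%N -> i + t%:Z \in I by apply: interval_convex.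
have cols t : (t <= e.+1)%N -> j + t%:Z \in J by apply: interval_convex.
have adjacent t : (t < d.+1)%N ->
    4 * (a (i + t%:Z) (j + e.+1%:Z) * a (i + t.+1%:Z) j) <=
    a (i + t%:Z) j * a (i + t.+1%:Z) (j + e.+1%:Z).
  move=> td; apply: (le4 e).
    by rewrite mulr_ge0 // ltW // a0 // rows // ltnW.
  have := @ratio_telescope R 4 (fun u => a (i + t%:Z) (j + u%:Z))
    (fun u => a (i + t.+1%:Z) (j + u%:Z)) e.+1.
  rewrite addr0 [a (i + t.+1%:Z) j * _]mulrC; apply=> // u ue.
  - by apply: a0; rewrite ?rows ?cols // ltnW.
  - by apply: a0; rewrite ?rows ?cols.
  - have uE : j + u.+1%:Z = j + u%:Z + 1 by lia.
    have tE : i + t.+1%:Z = i + t%:Z + 1 by lia.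
    have := h (i + t%:Z) (j + u%:Z) (rows t (ltnW td)); rewrite -uE -tE.
    move=> /(_ (rows _ td) (cols u (ltnW ue)) (cols _ ue)).
    apply: le_trans; rewrite [X in 4 * X]mulrC; apply: ler_wpM2r => //.
    rewrite mulr_ge0 // ltW //; apply: a0; rewrite ?rows ?cols //; exact: ltnW.
apply: (le4 d); first by rewrite mulr_ge0 // ltW // a0.
have := @ratio_telescope R 4 (fun u => a (i + u%:Z) j)
  (fun u => a (i + u%:Z) (j + e.+1%:Z)) d.+1.
by rewrite addr0; apply=> // u ud; apply: a0; rewrite ?rows.
Qed.

(** A third telescoping, over the selected rows, replaces the gain 4 by the
    power demanded of distant rows. *)
Lemma tp2_minor (R : realType) (c : R) (I J : interval int)
    (a : int -> int -> R) (n : nat) (r s : nat -> int) :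
  4 <= c -> TP2 c I J a ->
  (forall p, (p < n)%N -> r p \in I) -> (forall q, (q < n)%N -> s q \in J) ->
  (forall p p', (p < p' < n)%N -> r p < r p') ->
  (forall q q', (q < q' < n)%N -> s q < s q') ->
  tp2_4 n (fun p q => a (r p) (s q)).
Proof.
move=> c4 ha rI sJ rmono smono; have [a0 _] := ha.
split=> [p q pn qn|p p' q q' hp hq]; first by rewrite a0 ?rI ?sJ.
have := @ratio_telescope R 4 (fun t => a (r (p + t)%N) (s q))
  (fun t => a (r (p + t)%N) (s q')) (p' - p).
rewrite addn0 subnKC; last by lia.
apply=> // t tp.
- by apply: a0; [apply: rI; lia|apply: sJ; lia].
- by apply: a0; [apply: rI; lia|apply: sJ; lia].
- apply: (TP2_spread c4 ha).
  + by apply: rI; lia.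
  + by apply: rI; lia.
  + by apply: rmono; lia.
  + by apply: sJ; lia.
  + by apply: sJ; lia.
  + by apply: smono; lia.
Qed.

(** * Laplace expansion and the growth of its terms *)

Definition leading_minor (R : realType) (n : nat) (b : nat -> nat -> R) : R :=
  \det (\matrix_(p < n, q < n) b p q).

Definition del_col (R : realType) (j : nat) (b : nat -> nat -> R) :
  nat -> nat -> R := fun p q => b p (bump j q).

Definition laplace_term (R : realType) (n : nat) (b : nat -> nat -> R)
  (j : nat) : R := b n j * leading_minor n (del_col j b).

Definition tame_minors (R : realType) (n : nat) (b : nat -> nat -> R) : Prop :=
  forall m, (m < n)%N ->
    b m m * leading_minor m b <= 2 * leading_minor m.+1 b /\
    leading_minor m.+1 b <= b m m * leading_minor m b.

Lemma leading_minor0 (R : realType) (b : nat -> nat -> R) :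
  leading_minor 0 b = 1.
Proof. exact: det_mx00. Qed.

Lemma eq_leading_minor (R : realType) (n : nat) (b b' : nat -> nat -> R) :
  (forall p q, (p < n)%N -> (q < n)%N -> b p q = b' p q) ->
  leading_minor n b = leading_minor n b'.
Proof.
by move=> e; congr (\det _); apply/matrixP => p q; rewrite !mxE e.
Qed.

Lemma leading_minor_laplace (R : realType) (n : nat) (b : nat -> nat -> R) :
  leading_minor n.+1 b = \sum_(j < n.+1) (-1) ^+ (n + j) * laplace_term n b j.
Proof.
rewrite /leading_minor (expand_det_row _ ord_max); apply: eq_bigr => j _.
rewrite mxE /= /cofactor /= mulrCA; congr (_ * (_ * \det _)).
by apply/matrixP => p q; rewrite !mxE lift_max.
Qed.

Lemma alternating_sum_bounds (R : realType) (f : nat -> R) (n : nat) :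
  (forall j, (j <= n)%N -> 0 <= f j) ->
  (forall j, (j < n)%N -> 2 * f j <= f j.+1) ->
  f n <= 2 * (\sum_(j < n.+1) (-1) ^+ (n + j) * f j) /\
  \sum_(j < n.+1) (-1) ^+ (n + j) * f j <= f n.
Proof.
elim: n => [|n IH] f0 fS.
  by rewrite big_ord1 expr0 mul1r; have := f0 0 isT; lra.
have [] : f n <= 2 * (\sum_(j < n.+1) (-1) ^+ (n + j) * f j) /\
    \sum_(j < n.+1) (-1) ^+ (n + j) * f j <= f n.
  by apply: IH => j jn; [apply: f0|apply: fS]; lia.
have fn := f0 n (leqnSn n); have fnS := fS n (ltnSn n).
rewrite [X in _ -> _ -> _ <= 2 * X /\ X <= _]big_ord_recr /=.
rewrite addnn -mul2n exprM sqrrN expr1n expr1n mul1r.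
set S := \sum_(j < n.+1) _ => lo hi.
have -> : \sum_(j < n.+1) (-1) ^+ (n.+1 + j) * f j = - S.
  by rewrite -sumrN; apply: eq_bigr => j _; rewrite addSn exprS mulN1r mulNr.
by split; lra.
Qed.

(** Both bounds of tameness, iterated from order [j] to order [n]. *)
Lemma tame_diagonal_bounds (R : realType) (n j : nat) (b : nat -> nat -> R) :
  (forall i, (i < n)%N -> 0 < b i i) -> tame_minors n b -> (j <= n)%N ->
  [/\ leading_minor n b <= leading_minor j b * \prod_(j <= i < n) b i i,
      leading_minor j b * \prod_(j <= i < n) b i i
        <= 2 ^+ (n - j) * leading_minor n b
    & 0 < leading_minor n b].
Proof.
elim: n j => [|n IH] j b0 tame jn.
  have -> : j = 0%N by lia.
  by rewrite big_geq // leading_minor0; split; lra.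
have {}IH k : (k <= n)%N ->
  [/\ leading_minor n b <= leading_minor k b * \prod_(k <= i < n) b i i,
      leading_minor k b * \prod_(k <= i < n) b i i
        <= 2 ^+ (n - k) * leading_minor n b
    & 0 < leading_minor n b].
  by move=> kn; apply: IH => // i hi; [apply: b0|apply: tame]; lia.
have [lo hi] := tame n (ltnSn n).
have bn : 0 < b n n by exact: b0.
have [_ _ dn] := IH 0%N (leq0n n).
have dS : 0 < leading_minor n.+1 b.
  by have := mulr_gt0 bn dn; lra.
move: jn; rewrite leq_eqVlt ltnS => /orP[/eqP->|jn].
  by rewrite big_geq // subnn expr0 mul1r mulr1.
have [up down _] := IH j jn.
rewrite big_nat_recr //= mulrA; split=> //.
  by apply: (le_trans hi); rewrite mulrC ler_pM2r.
have -> : (n.+1 - j = (n - j).+1)%N by lia.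
rewrite exprSr.
apply: (@le_trans _ _ (2 ^+ (n - j) * leading_minor n b * b n n)).
  by rewrite ler_pM2r.
by rewrite -!mulrA ler_pM2l ?exprn_gt0 // mulrC.
Qed.

(** The condition on [n + 1] rows gives all the complementary minors of the last
    row.  Deleting a column only increases distances between columns, which the
    condition does not measure. *)
Lemma tp2_del_col (R : realType) (n j : nat) (b : nat -> nat -> R) :
  tp2_4 n.+1 b -> tp2_4 n (del_col j b).
Proof.
move=> [b0 h]; split=> [p q pn qn|p p' q q' hp hq]; rewrite /del_col.
  by apply: b0; rewrite /bump; lia.
by apply: h; rewrite /bump; lia.
Qed.

(** The two complementary minors compared here share their leading minor
    of order [j] and, except for one factor, the diagonal beyond it. *)
Lemma laplace_term_growth (R : realType) (n j : nat) (b : nat -> nat -> R) :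
  tp2_4 n.+1 b ->
  (forall k, tame_minors n (del_col k b)) -> (j < n)%N ->
  2 * laplace_term n b j <= laplace_term n b j.+1.
Proof.
move=> tb tame jn; have [b0 h] := tb.
have diag k i : (i < n)%N -> 0 < del_col k b i i.
  by move=> hi; have [d0 _] := tp2_del_col k tb; exact: d0.
have [up _ pos_j] := tame_diagonal_bounds (diag j) (tame j) (ltnW jn).
have [_ lo pos] := tame_diagonal_bounds (diag j.+1) (tame j.+1) (ltnW jn).
have jb k : (j <= k)%N -> leading_minor j (del_col k b) = leading_minor j b.
  move=> jk; apply: eq_leading_minor => p q _ qj.
  by rewrite /del_col /bump; congr (b _ _); lia.
have tail k : (k <= j.+1)%N -> \prod_(j.+1 <= i < n) del_col k b i i =
    \prod_(j.+1 <= i < n) b i i.+1.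
  move=> kj; apply: eq_big_nat => i hi.
  by rewrite /del_col /bump; congr (b _ _); lia.
rewrite big_ltn // tail // jb // in up; rewrite big_ltn // tail // jb // in lo.
move: up lo.
have -> : del_col j b j j = b j j.+1 by rewrite /del_col /bump leqnn.
have -> : del_col j.+1 b j j = b j j by rewrite /del_col /bump ltnn.
have X0 : 0 < \prod_(j.+1 <= i < n) b i i.+1.
  rewrite big_nat_cond; apply: prodr_gt0 => i hi; apply: b0; lia.
have L0 : 0 < leading_minor j b.
  rewrite -(jb j) //.
  have tame_j : tame_minors j (del_col j b).
    by move=> m hm; apply: tame; lia.
  have diag_j i : (i < j)%N -> 0 < del_col j b i i.
    by move=> hi; apply: diag; lia.
  by have [] := tame_diagonal_bounds diag_j tame_j (leqnn j).
set L := leading_minor j b in L0 *; set X := \prod_(_ <= _ < _) _ in X0 *.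
rewrite /laplace_term; set Dj := leading_minor n (del_col j b) in pos_j *.
set Dk := leading_minor n (del_col j.+1 b) in pos *.
move=> up lo.
have gain : 4 ^+ (n - j) * (b j j.+1 * b n j) <= b j j * b n j.+1.
  by apply: h; lia.
have bnj : 0 < b n j by apply: b0; lia.
have bnk : 0 < b n j.+1 by apply: b0; lia.
have p2 : (0 : R) < 2 ^+ (n - j) by rewrite exprn_gt0.
have two : (2 : R) <= 2 ^+ (n - j).
  have -> : (n - j = (n - j).-1.+1)%N by lia.
  by rewrite exprS ler_peMr // exprn_ege1 // (_ : 1 = 1%:R) // ler_nat.
have four : (4 : R) ^+ (n - j) = 2 ^+ (n - j) * 2 ^+ (n - j).
  by rewrite -exprMn -natrM.
(* Of the two factors [2 ^ (n - j)] that make up [4 ^ (n - j)], one pays for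
   the lower bound [lo]; the other is at least 2, the growth claimed. *)
rewrite -(ler_pM2l p2).
apply: (@le_trans _ _ (2 ^+ (n - j) * (2 ^+ (n - j) * (b n j * Dj)))).
  by rewrite ler_pM2l // ler_pM2r // mulr_gt0.
apply: (@le_trans _ _ (4 ^+ (n - j) * (b j j.+1 * b n j) * (L * X))).
  rewrite four.
  have -> : 2 ^+ (n - j) * 2 ^+ (n - j) * (b j j.+1 * b n j) * (L * X) =
    2 ^+ (n - j) * (2 ^+ (n - j) * (b n j * (L * (b j j.+1 * X)))) by ring.
  by rewrite !ler_pM2l.
apply: (@le_trans _ _ (b j j * b n j.+1 * (L * X))).
  by rewrite ler_pM2r // mulr_gt0.
have -> : b j j * b n j.+1 * (L * X) = b n j.+1 * (L * (b j j * X)) by ring.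
by rewrite [leRHS]mulrCA ler_pM2l.
Qed.

(** * Positivity of the minors *)

Lemma tp2_tame (R : realType) (n : nat) (b : nat -> nat -> R) :
  tp2_4 n b -> tame_minors n b.
Proof.
elim: n b => [|n IH] b tb m; first by [].
rewrite ltnS leq_eqVlt => /orP[/eqP->|]; last first.
  by apply: IH; apply: tp2_4_sub tb.
have [b0 _] := tb.
have tame k : tame_minors n (del_col k b) by apply/IH/tp2_del_col.
have term0 j : (j <= n)%N -> 0 <= laplace_term n b j.
  move=> jn; apply: mulr_ge0; first by rewrite ltW // b0.
  have diag i : (i < n)%N -> 0 < del_col j b i i.
    by move=> hi; have [d0 _] := tp2_del_col j tb; exact: d0.
  by have [_ _ /ltW] := tame_diagonal_bounds diag (tame j) (leqnn n).
have last_term : laplace_term n b n = b n n * leading_minor n b.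
  congr (_ * _); apply: eq_leading_minor => p q _ qn.
  by rewrite /del_col /bump leqNgt qn.
(* The bounds on the alternating sum are exactly the two tameness bounds. *)
rewrite -last_term leading_minor_laplace.
by apply: alternating_sum_bounds => // j jn; apply: laplace_term_growth.
Qed.

Theorem theorem3 (R : realType) (c : R) (hc : 4 <= c) (I J : interval int)
  (a : int -> int -> R) : TP2 c I J a -> STP I J a.
Proof.
move=> ha [|k] r s rI sJ rmono smono; first by rewrite /minor det_mx00.
have tb : tp2_4 k.+1 (fun p q => a (r (inord p)) (s (inord q))).
  apply: (@tp2_minor _ c I J a k.+1 (r \o inord) (s \o inord)) => //=.
  - by move=> p p' hp; apply: rmono; rewrite !inordK; lia.
  - by move=> p p' hp; apply: smono; rewrite !inordK; lia.
have diag p : (p < k.+1)%N -> 0 < a (r (inord p)) (s (inord p)).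
  by move=> pk; have [b0 _] := tb; exact: b0.
have [_ _] := tame_diagonal_bounds diag (tp2_tame tb) (leqnn _).
rewrite /leading_minor /minor; congr (0 < \det _).
by apply/matrixP => p q; rewrite !mxE !inord_val.
Qed.
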